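(* Every graph sequence $\mathcal{G}=\{G_n\}_{n\in\mathbb{N}}$ that has property A is hyperfinite.
   Context: A graph sequence $\mathcal{G}=\{G_n\}_{n\in\mathbb{N}}$ is a sequence of finite connected graphs whose vertex degrees are bounded by a constant $d$ independent of $n$, with $\lim_{n\to\infty}|V(G_n)|=\infty$. Here $V(G)$ and $E(G)$ denote vertex and edge sets; each graph carries its path metric. Property A: $\mathcal{G}=\{G_n\}$ has property A if for every $\epsilon>0$ there exist $S>0$ and a function $\xi:\bigsqcup_n V(G_n)\to \ell^1(\bigsqcup_n V(G_n))$, $x\mapsto\xi_x$, such that (1) $\|\xi_x\|_1=1$ for all $x$; (2) $\xi_x$ is supported in the ball of radius $S$ about $x$ (vertices of different graphs being regarded as infinitely far apart); (3) $\|\xi_x-\xi_y\|_1<\epsilon$ whenever $(x,y)$ is an edge of some $G_n$. Hyperfiniteness: $\mathcal{G}$ is hyperfinite if for every $\epsilon>0$ there exist a constant $K>0$ and edge sets $E_n^\epsilon\subset E(G_n)$ ($n\in\mathbb{N}$) such that $\lim_{n\to\infty}\frac{|E_n^\epsilon|}{|V(G_n)|}<\epsilon$ and, for every $n$, each connected component of $G_n\setminus E_n^\epsilon$ contains at most $K$ vertices. *)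

(* Defs.v *)
From HB Require Import structures.
From mathcomp Require Import all_boot all_order all_algebra.
From mathcomp Require Import all_classical all_reals all_analysis.

Set Implicit Arguments.
Unset Strict Implicit.
Unset Printing Implicit Defensive.

Import Order.TTheory GRing.Theory Num.Theory.
Import numFieldNormedType.Exports.

Local Open Scope classical_set_scope.
Local Open Scope ring_scope.

Record sgraph := SGraph {
  vertex :> finType;
  adj : rel vertex;
  adj_sym : symmetric adj;
  adj_irr : irreflexive adj
}.

(* Edges are unordered, so that #|edges G| counts each edge once. *)
Definition edges (G : sgraph) : {set {set G}} :=
  [set [set p.1; p.2]%SET | p : G * G & adj p.1 p.2]%SET.

Definition degree (G : sgraph) (x : G) : nat := #|[pred y | adj x y]|.

Definition graph_connected (G : sgraph) : Prop :=
  (0 < #|G|)%N /\ forall x y : G, connect (@adj G) x y.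

Definition components (G : sgraph) : {set {set G}} :=
  [set [set y | connect (@adj G) x y]%SET | x : G]%SET.

Section DeleteEdges.
Variables (G : sgraph) (E : {set {set G}}).

Definition del_adj : rel G :=
  fun x y => adj x y && ([set x; y]%SET \notin E).

Lemma del_adj_sym : symmetric del_adj.
Proof. by move=> x y; rewrite /del_adj adj_sym finset.setUC. Qed.

Lemma del_adj_irr : irreflexive del_adj.
Proof. by move=> x; rewrite /del_adj adj_irr. Qed.

Definition delete_edges : sgraph := SGraph del_adj_sym del_adj_irr.

End DeleteEdges.

(* The infimum is +oo when no path joins x to y. *)
Definition path_dist (R : realType) (G : sgraph) (x y : G) : \bar R :=
  ereal_inf [set ((size p)%:R)%:E | p in
               [set p : seq G | path (@adj G) x p /\ last x p = y]].

Definition graph_sequence (G : nat -> sgraph) : Prop :=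
  [/\ forall n, graph_connected (G n),
      exists d : nat, forall n (x : G n), (degree x <= d)%N
    & (fun n => #|G n|) @ \oo --> \oo].

Definition union_vertex (G : nat -> sgraph) : choiceType :=
  {n : nat & vertex (G n)}.

Definition in_union (G : nat -> sgraph) (n : nat) (x : G n) : union_vertex G :=
  Tagged (fun n => vertex (G n)) x.

(* [tagged_as u v] is [tagged v] transported to the graph containing u. *)
Definition union_dist (R : realType) (G : nat -> sgraph)
    (u v : union_vertex G) : \bar R :=
  if tag u == tag v then path_dist R (tagged u) (tagged_as u v) else +oo%E.

Definition l1norm (R : realType) (T : choiceType) (f : T -> R) : \bar R :=
  \esum_(t in [set: T]) `|f t|%:E.

Definition in_l1 (R : realType) (T : choiceType) (f : T -> R) : Prop :=
  summable [set: T] (EFin \o f).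

Definition property_A (R : realType) (G : nat -> sgraph) : Prop :=
  forall eps : R, 0 < eps ->
  exists (S : R) (xi : union_vertex G -> union_vertex G -> R),
    [/\ 0 < S,
        forall x, in_l1 (xi x) /\ l1norm (xi x) = 1%E,
        forall x y, xi x y != 0 -> (union_dist R x y <= S%:E)%E
      & forall n (x y : G n), adj x y ->
          (l1norm (fun z => (xi (in_union x) z - xi (in_union y) z)%R)
             < eps%:E)%E].

Definition hyperfinite (R : realType) (G : nat -> sgraph) : Prop :=
  forall eps : R, 0 < eps ->
  exists (K : nat) (E : forall n, {set {set G n}}),
    [/\ (0 < K)%N,
        forall n, E n \subset edges (G n),
        exists2 l : R,
          (fun n => (#|E n|)%:R / (#|G n|)%:R : R) @ \oo --> l & l < eps
      & forall n (C : {set G n}),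
          C \in components (delete_edges (E n)) -> (#|C| <= K)%N].

(* Main.v *)
(* Property A passes to every finite vertex set F: applying the coarea inequality
   to the functions x |-> |xi_x(z)| on F and summing over z yields a superlevel
   set E inside a ball of radius S whose boundary in F is small compared to E.
   Cutting E off from F and repeating on F \ E decomposes the whole graph into
   pieces of bounded size at the cost of few edges. To make the edge densities
   converge, the cut is enlarged to exactly floor(a |V(G_n)|) edges. *)
Require Import Defs.
From mathcomp Require Import all_boot all_order all_algebra.
From mathcomp Require Import all_classical all_reals all_analysis.

Set Implicit Arguments.
Unset Strict Implicit.
Unset Printing Implicit Defensive.

Import Order.TTheory GRing.Theory Num.Theory.
Import numFieldNormedType.Exports.

Local Open Scope ring_scope.

Local Notation inE := finset.inE.

(** * Coarea inequality, balls and greedy decomposition for relations on a finite set *)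

Section FiniteGraphs.
Variable V : finType.
Implicit Types (e : rel V) (E F : {set V}).

(** The induced subgraph stays on the full type [V], so that the recursion over shrinking [F] needs
    no change of vertex type. *)
Definition restr_rel e F : rel V := fun x y => [&& x \in F, y \in F & e x y].

(** Only outward pairs are kept: for symmetric [e], each boundary edge is counted once although [e]
    is a set of ordered pairs. *)
Definition edge_boundary e E : {set V * V} :=
  [set p | [&& e p.1 p.2, p.1 \in E & p.2 \notin E]]%SET.

(* A discrete coarea inequality, proved by peeling off superlevel sets: with E
   the support of f and m its least value on E, replacing f by f - m 1_E lowers
   the right-hand side by at least m times the boundary of E. *)
Lemma coarea (R : realDomainType) e (c : R) (f : V -> R) :
  (forall x, 0 <= f x) ->
  (forall E, (forall x, x \in E -> 0 < f x) ->
     c * #|E|%:R <= #|edge_boundary e E|%:R) ->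
  c * \sum_x f x <= \sum_(p : V * V | e p.1 p.2) `|f p.1 - f p.2|.
Proof.
have [n] := ubnP #|[set x | 0 < f x]%SET|.
elim: n f => // n IHn f lefn f0 fE.
set E := [set x | 0 < f x]%SET in lefn.
have inEf x : (x \in E) = (0 < f x) by rewrite inE.
have fNE x : x \notin E -> f x = 0.
  by rewrite inEf lt_neqAle f0 andbT negbK => /eqP.
have [E0|[x0 x0E]] := set_0Vmem E.
  rewrite big1 ?mulr0; first by apply: sumr_ge0.
  by move=> x _; apply: fNE; rewrite E0 inE.
case: (arg_minP f x0E) => x1 x1E' x1min.
have x1E : x1 \in E := x1E'; set m := f x1 in x1min.
have m0 : 0 < m by rewrite -inEf.
pose g x := f x - m * (x \in E)%:R.
have fg x : f x = g x + m * (x \in E)%:R by rewrite /g subrK.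
have g0 x : 0 <= g x.
  rewrite /g; case: (boolP (x \in E)) => xE; last by rewrite mulr0 subr0.
  by rewrite mulr1 subr_ge0 x1min.
have gf x : g x <= f x by rewrite fg lerDl mulr_ge0 // ltW.
have IHg : c * \sum_x g x <= \sum_(p : V * V | e p.1 p.2) `|g p.1 - g p.2|.
  apply: IHn => //.
    (* The support shrinks strictly, because the minimizer [x1] drops out of it. *)
    rewrite -ltnS; apply: leq_trans lefn; rewrite ltnS.
    apply: proper_card; apply/properP; split.
      by apply/fintype.subsetP => x; rewrite !inE => /lt_le_trans; apply.
    by exists x1 => //; rewrite inE /= /g x1E mulr1 subrr ltxx.
  by move=> A gA; apply: fE => x /gA /lt_le_trans; apply.
have sumE : \sum_x f x = \sum_x g x + m * #|E|%:R.
  rewrite (eq_bigr (fun x => g x + m * (x \in E)%:R)) // big_split /=.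
  rewrite -mulr_sumr -sum1_card natr_sum.
  by congr (_ + _ * _); rewrite [RHS]big_mkcond;
    apply: eq_bigr => x _; case: (x \in E).
have bdE : #|edge_boundary e E|%:R =
    \sum_(p : V * V | e p.1 p.2) ((p.1 \in E) && (p.2 \notin E))%:R :> R.
  rewrite -sum1_card natr_sum big_mkcond [RHS]big_mkcond.
  by apply: eq_bigr => p _; rewrite inE; case: (e _ _) => //=;
    case: (_ && _).
rewrite sumE mulrDr mulrCA.
apply: (@le_trans _ _ (\sum_(p : V * V | e p.1 p.2) `|g p.1 - g p.2|
   + m * #|edge_boundary e E|%:R)).
  by rewrite lerD // ler_pM2l // fE // => x; rewrite inEf.
(* Termwise: pairs inside [E] or outside [E] keep their difference, pairs leaving [E] lose exactly
   [m], and for pairs entering [E] the gain is discarded. *)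
rewrite bdE mulr_sumr -big_split /=; apply: ler_sum => -[x y] _ /=.
case: (boolP (x \in E)) => xE; case: (boolP (y \in E)) => yE /=;
  rewrite (fg x) (fg y) ?xE ?yE ?(negPf xE) ?(negPf yE) ?mulr0 ?mulr1 ?addr0 //.
- by rewrite (addrC (g y)) addrKA.
- have -> : g y = 0.
    by apply/eqP; rewrite eq_le g0 andbT -(fNE y yE) gf.
  by rewrite !subr0 [`|g x|]ger0_norm // ger0_norm // addr_ge0 // ltW.
- have -> : g x = 0.
    by apply/eqP; rewrite eq_le g0 andbT -(fNE x xE) gf.
  rewrite !sub0r !normrN !ger0_norm ?lerDl ?(ltW m0) //.
  by rewrite addr_ge0 // ltW.
Qed.

Definition graph_ball e m z : {set V} :=
  iter m (fun B => B :|: \bigcup_(y in B) [set x | e y x])%SET [set z]%SET.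

Lemma card_graph_ball e d m z :
  (forall x, (#|[pred y | e x y]| <= d)%N) ->
  (#|graph_ball e m z| <= d.+1 ^ m)%N.
Proof.
move=> ed; elim: m => [|m IHm]; first by rewrite cards1.
rewrite /graph_ball iterS -/(graph_ball e m z) expnS mulSn.
apply: leq_trans (leq_card_setU _ _) _; apply: leq_add => //.
apply: (@leq_trans (\sum_(y in graph_ball e m z) d)).
  elim/big_ind2: _ => [|A a B b leA leB|y _]; first by rewrite cards0.
    by apply: leq_trans (leq_card_setU _ _) (leq_add leA leB).
  by rewrite cardsE; apply: ed.
by rewrite sum_nat_const mulnC leq_mul.
Qed.

(** The ball is centred at the end of the path, so induction removes the first edge of the path and
    one unit of radius; symmetry reverses that edge. *)
Lemma graph_ball_path e m x p :
  symmetric e -> path e x p -> (size p <= m)%N ->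
  x \in graph_ball e m (last x p).
Proof.
move=> es; elim: m x p => [|m IHm] x [|y p] //=; rewrite ?inE ?eqxx //.
  move=> _ _; have := IHm x [::] isT isT.
  by rewrite /graph_ball => ->.
case/andP=> exy yp lepm; apply/orP; right; apply/bigcupP; exists y.
  exact: IHm.
by rewrite inE es.
Qed.

(* The label of a vertex is the piece of the decomposition containing it;
   the factor 2 appears because the pairs (x, y) are ordered. *)
Lemma greedy_decomposition (R : realFieldType) e (c : R) K :
  symmetric e ->
  (forall F, F != finset.set0 -> exists E,
     [/\ E \subset F, E != finset.set0, (#|E| <= K)%N
       & #|edge_boundary (restr_rel e F) E|%:R <= c * #|E|%:R]) ->
  forall F, exists l : V -> {set V},
    (forall x, x \in F -> x \in l x /\ (#|l x| <= K)%N) /\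
    #|[set p : V * V | restr_rel e F p.1 p.2 & l p.1 != l p.2]%SET|%:R
      <= c *+ 2 * #|F|%:R.
Proof.
move=> es small F; have [n] := ubnP #|F|; elim: n F => // n IHn F leFn.
have [->|F0] := eqVneq F finset.set0.
  exists (fun=> finset.set0); split=> [x|]; first by rewrite inE.
  rewrite cards0 mulr0 (_ : [set _ | _]%SET = finset.set0) ?cards0 //.
  by apply/finset.setP => p; rewrite !inE /restr_rel !inE.
have [E [EF E0 EK Ec]] := small F F0.
have cardF : #|F| = (#|E| + #|F :\: E|)%N.
  by rewrite -(cardsID E F) (finset.setIidPr EF).
have [|l [lF lc]] := IHn (F :\: E)%SET.
  rewrite -ltnS; apply: leq_trans leFn; rewrite ltnS cardF.
  by rewrite -[X in (X < _)%N]add0n ltn_add2r card_gt0.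
exists (fun x => if x \in E then E else l x); split=> [x xF|].
  by case: ifP => // xE; apply: lF; rewrite inE xE.
set D := edge_boundary _ E in Ec.
set B := [set p | _ & l _ != _]%SET in lc.
set A := [set p | _ & _]%SET.
pose sw (p : V * V) := (p.2, p.1).
(* Two vertices of [E] share a label, so a cut pair leaves [E], enters [E], or avoids [E] and is
   already cut in [F :\: E]. *)
have sAB : A \subset (D :|: (sw @: D) :|: B)%SET.
  apply/fintype.subsetP => -[x y]; rewrite !inE /= /restr_rel /= !inE.
  case: (boolP (x \in E)) => xE; case: (boolP (y \in E)) => yE;
    rewrite ?eqxx ?andbF ?orbF ?andbT //=.
  - by case/andP=> /and3P[-> -> ->].
  - case/andP=> /and3P[xF yF exy] _.
    apply/imsetP; exists (y, x) => //.
    by rewrite !inE /= /restr_rel xE yE xF yF es exy.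
  - by case/andP=> /and3P[-> -> ->] ->; rewrite orbT.
have swD : (#|sw @: D| <= #|D|)%N by apply: leq_imset_card.
have leA : (#|A| <= #|D| + #|D| + #|B|)%N.
  apply: leq_trans (subset_leq_card sAB) _.
  apply: leq_trans (leq_card_setU _ _) _; rewrite leq_add2r.
  by apply: leq_trans (leq_card_setU _ _) _; rewrite leq_add2l.
apply: (@le_trans _ _ (#|D| + #|D| + #|B|)%:R); first by rewrite ler_nat.
rewrite !natrD cardF natrD mulrDr; apply: lerD => //.
by rewrite mulrnAl mulr2n lerD.
Qed.

Lemma card_restr_rel e d F :
  (forall x, (#|[pred y | e x y]| <= d)%N) ->
  (#|[pred p : V * V | restr_rel e F p.1 p.2]| <= #|F| * d)%N.
Proof.
move=> ed.
have -> : #|[pred p : V * V | restr_rel e F p.1 p.2]| =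
    (\sum_(x in F) \sum_(y | (y \in F) && e x y) 1)%N.
  by rewrite pair_big_dep -sum1_card.
rewrite -sum_nat_const; apply: leq_sum => x _; apply: leq_trans (ed x).
rewrite sum1dep_card; apply/subset_leq_card/fintype.subsetP => y.
by rewrite !inE => /andP[].
Qed.

End FiniteGraphs.

(** * Distances, edge counts and components in a single graph *)

Section Edges.
Variable G : sgraph.

(** The distance is an infimum, so a path of length below [S + 1] is extracted instead of a
    minimizing one; this costs one unit of radius. *)
Lemma path_ball (R : realType) (x z : G) (S : R) :
  (path_dist R x z <= S%:E)%E -> x \in graph_ball (@adj G) (Num.truncn S).+1 z.
Proof.
move=> dS; have S1 : (path_dist R x z < (S + 1)%:E)%E.
  by apply: le_lt_trans dS _; rewrite lte_fin ltrDl.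
have [_ [p [pp <-] <-]] := ereal_inf_lt S1.
rewrite lte_fin => ltp; apply: graph_ball_path (@adj_sym G) pp _.
have [S0|S0] := leP 0 S.
  rewrite -ltnS -(ltr_nat R); apply: lt_trans ltp _.
  by rewrite -[_.+2]addn1 natrD ltrD2r; have /andP[] := truncn_itv S0.
have : (size p < 1)%N.
  by rewrite -(ltr_nat R) (lt_trans ltp) // -[ltRHS]add0r ltrD2r.
by case: (size p).
Qed.

(** By connectedness every vertex lies on an edge, and an edge covers at most two vertices. This
    guarantees enough edges for the padding of cuts. *)
Lemma card_vertices_edges :
  graph_connected G -> (1 < #|G|)%N -> (#|G| <= 2 * #|edges G|)%N.
Proof.
move=> [_ conn] cG.
have nbr (x : G) : exists y, adj x y.
  have [y yx] : exists y, y != x.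
    apply/existsP; apply/contraT; rewrite negb_exists => /forallP all1.
    move: cG; rewrite ltnNge -(cards1 x) => /negP[]; rewrite -finset.cardsT.
    by apply/subset_leq_card/fintype.subsetP => y _; rewrite inE -[_ == _]negbK.
  have /connectP[[|z p] /=] := conn x y.
    by move=> _ yE; rewrite yE eqxx in yx.
  by case/andP => xz _ _; exists z.
have edge_cover : [set: G]%SET \subset finset.cover (edges G).
  apply/fintype.subsetP => x _; have [y xy] := nbr x.
  apply/bigcupP; exists [set x; y]%SET; last by rewrite !inE eqxx.
  by apply/imsetP; exists (x, y); rewrite ?inE.
rewrite -finset.cardsT; apply: leq_trans (subset_leq_card edge_cover) _.
apply: leq_trans (leq_card_cover _).1 _.
rewrite mulnC -sum_nat_const; apply: leq_sum => _ /imsetP[[x y] _ ->].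
by rewrite cards2; case: eqP.
Qed.

(** Labels are constant along undeleted edges, so the component of [x] is contained in [l x]. *)
Lemma component_delete (l : G -> {set G}) (E : {set {set G}}) (C : {set G}) K :
  (forall x y, adj x y -> l x != l y -> [set x; y]%SET \in E) ->
  (forall x, x \in l x) -> (forall x, (#|l x| <= K)%N) ->
  C \in components (delete_edges E) -> (#|C| <= K)%N.
Proof.
move=> El lin lK /imsetP[x _ ->]; apply: leq_trans (lK x).
apply/subset_leq_card/fintype.subsetP => y; rewrite inE => /connectP[p].
suff : path (adj (s := delete_edges E)) x p -> l (last x p) = l x.
  by move=> h /h <- ->; apply: lin.
elim: p x {C} => //= z p IHp x /andP[/andP[xz xzE] /IHp ->].
by apply/esym/eqP; apply: contraNT xzE => /El; apply.
Qed.

Lemma pad_edges (E : {set {set G}}) m :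
  E \subset edges G -> (#|E| <= m <= #|edges G|)%N ->
  exists E' : {set {set G}}, [/\ E \subset E', E' \subset edges G & #|E'| = m].
Proof.
move=> sE /andP[]; elim: m => [|m IHm] leE lem.
  by exists E; split => //; apply/eqP; rewrite -leqn0.
move: leE; rewrite leq_eqVlt => /predU1P[Em|]; first by exists E.
rewrite ltnS => /IHm /(_ (ltnW lem)) [E' [sE1 sE2 cE]].
have /subsetPn[u uG uE] : ~~ (edges G \subset E').
  by apply/negP => /subset_leq_card; rewrite cE leqNgt lem.
exists (u |: E')%SET; split; last by rewrite cardsU1 uE cE.
  by apply: fintype.subset_trans sE1 (finset.subsetU1 _ _).
by rewrite finset.subUset finset.sub1set uG.
Qed.

End Edges.

(** * From property A to sets of bounded size with small boundary *)

Section PropertyA.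
Variables (R : realType) (G : nat -> sgraph).

Lemma in_union_inj n : injective (@in_union G n).
Proof.
by move=> x y /eqP; rewrite -tag_eqE /tag_eq eqxx /= tagged_asE => /eqP.
Qed.

Lemma esum_in_union (n : nat) (f : union_vertex G -> R) :
  (\esum_(u in range (@in_union G n)) `|f u|%:E
     = (\sum_(z : G n) `|f (in_union z)|)%:E)%E.
Proof.
rewrite (reindex_esum [set: G n]%classic _ (@in_union G n)); last first.
  split=> [x _|x y _ _ /in_union_inj//|_ [x _ <-]]; first by exists x.
  by exists x.
rewrite esum_fset //; last exact: finite_finset.
rewrite (fsbigE (enum (G n))) ?enum_uniq //; last first.
  by move=> z _; rewrite mem_enum.
rewrite big_enum_cond /= sumEFin; congr (_%:E).
by apply: eq_bigl => z; rewrite classical_sets.in_setT.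
Qed.

Lemma l1norm_graph (n : nat) (f : union_vertex G -> R) :
  ((\sum_(z : G n) `|f (in_union z)|)%:E <= l1norm f)%E.
Proof.
rewrite -esum_in_union esum_mkcond; apply: le_esum => u _.
by case: ifP => // _; rewrite lee_fin.
Qed.

Lemma l1norm_supported (n : nat) (f : union_vertex G -> R) :
  (forall z, f z != 0 -> tag z = n) ->
  l1norm f = (\sum_(z : G n) `|f (in_union z)|)%:E.
Proof.
move=> fn; rewrite -esum_in_union esum_mkcond; apply: eq_esum => u _.
case: ifPn => // /negP; rewrite in_setE => un.
suff -> : f u = 0 by rewrite normr0.
apply/eqP; apply: contrapT => /negP /fn; case: u un => m x /= un mn.
by subst m; case: un; exists x.
Qed.

Lemma union_dist_tag (u v : union_vertex G) (S : R) :
  (union_dist R u v <= S%:E)%E -> tag u = tag v.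
Proof. by rewrite /union_dist; case: eqP => // _; rewrite leye_eq. Qed.

Lemma union_dist_in (n : nat) (x y : G n) :
  union_dist R (in_union x) (in_union y) = path_dist R x y.
Proof. by rewrite /union_dist /= eqxx tagged_asE. Qed.

(** If no such [E] existed in [F], coarea summed over all centres [z] would bound [c * #|F|] by the
    total variation of [xi] over the edges in [F], which is smaller. [K] bounds the size of a ball,
    uniformly in [n] and [F]. *)
Lemma property_A_small_boundary (d : nat) (c : R) :
  (forall n (x : G n), (degree x <= d)%N) -> property_A R G -> 0 < c ->
  exists K : nat, forall n (F : {set G n}), F != finset.set0 ->
    exists E : {set G n}, [/\ E \subset F, E != finset.set0, (#|E| <= K)%N
      & #|edge_boundary (restr_rel (@adj (G n)) F) E|%:R <= c * #|E|%:R].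
Proof.
move=> deg A c0; have d0 : 0 < d.+1%:R :> R by rewrite ltr0n.
(* There are at most [d * #|F|] ordered pairs in [F]; dividing by [d.+1] makes the final comparison
   strict and is safe when [d] is 0. *)
have [S [xi [S0 xi1 xiS xie]]] := A (c / d.+1%:R) (divr_gt0 c0 d0).
exists (d.+1 ^ (Num.truncn S).+1)%N => n F F0.
apply: contrapT => noE.
pose h (z x : G n) := if x \in F then `|xi (in_union x) (in_union z)| else 0.
set e := restr_rel (@adj (G n)) F in noE.
have h_coarea z : c * \sum_x h z x <=
    \sum_(p : G n * G n | e p.1 p.2) `|h z p.1 - h z p.2|.
  (* Any set on which [h z] is positive lies in [F] and in a ball about [z]; with a small boundary
     it would contradict [noE]. *)
  apply: coarea => [x|E Epos]; first by rewrite /h; case: ifP.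
  rewrite leNgt; apply/negP => Elt; apply: noE; exists E.
  have EF : E \subset F.
    apply/fintype.subsetP => x /Epos; rewrite /h; case: ifP => //.
    by rewrite ltxx.
  split=> //; last exact: ltW.
    by apply: contraTneq Elt => ->; rewrite cards0 mulr0 -leNgt.
  apply: leq_trans (card_graph_ball (Num.truncn S).+1 z (deg n)).
  apply/subset_leq_card/fintype.subsetP => x xE; apply: (@path_ball _ R x z S).
  rewrite -union_dist_in; apply: xiS.
  by have := Epos x xE; rewrite /h (fintype.subsetP EF) // normr_gt0.
have hsum x : x \in F -> \sum_z h z x = 1.
  move=> xF; have [_ /eqP] := xi1 (in_union x).
  rewrite (@l1norm_supported n) => [|z /xiS /union_dist_tag <- //].
  rewrite eqe => /eqP <-; apply: eq_bigr => z _; by rewrite /h xF.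
have hdiff (p : G n * G n) : e p.1 p.2 ->
    \sum_z `|h z p.1 - h z p.2| <= c / d.+1%:R.
  case: p => x y /= /and3P[xF yF /xie/ltW].
  move=> /(le_trans (l1norm_graph n _)); rewrite lee_fin; apply: le_trans.
  by apply: ler_sum => z _; rewrite /h xF yF ler_dist_dist.
have card_e := card_restr_rel F (deg n).
have sumF : \sum_z \sum_x h z x = #|F|%:R.
  rewrite exchange_big /= -sum1_card natr_sum [RHS]big_mkcond.
  apply: eq_bigr => x _; case: ifP => xF; first exact: hsum.
  by rewrite big1 // => z _; rewrite /h xF.
have : c * #|F|%:R <= c / d.+1%:R * (#|F| * d)%:R.
  rewrite -sumF mulr_sumr.
  apply: (le_trans (ler_sum _ (fun z _ => h_coarea z))).
  rewrite exchange_big /=; apply: (le_trans (ler_sum _ hdiff)).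
  rewrite sumr_const -[leLHS]mulr_natr.
  apply: ler_wpM2l; last by rewrite ler_nat.
  by rewrite ltW // divr_gt0.
(* The contradiction is [d < d.+1], after cancelling [c] and the nonzero [#|F|]. *)
apply/negP; rewrite -ltNge -mulrA ltr_pM2l // ltr_pdivrMl // natrM [ltRHS]mulrC.
by rewrite ltr_pM2l ?ltr0n ?card_gt0 // ltr_nat.
Qed.

End PropertyA.

(** * Cutting every graph with a prescribed edge density *)

Theorem theorem0p8 (R : realType) (G : nat -> sgraph) :
  graph_sequence G -> property_A R G -> hyperfinite R G.
Proof.
move=> [conn [d deg] Gy] A eps eps0.
(* [a] is the limit density: it must lie below [eps], and [a * 2 <= 1] ensures that each graph has
   at least [Num.truncn (a * #|G n|%:R)] edges. *)
pose a : R := Num.min eps 1 / 2.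
have a0 : 0 < a by rewrite divr_gt0 // lt_min eps0 ltr01.
have ae : a < eps.
  rewrite /a ltr_pdivrMr // (@le_lt_trans _ _ eps) ?ge_min ?lexx //.
  by rewrite ltr_pMr // ltr1n.
have a2 : a * 2 <= 1 by rewrite /a mulfVK // ge_min lexx orbT.
(* The constant [a / 2] absorbs the factor 2 of the greedy decomposition. *)
have [K small] := property_A_small_boundary deg A (divr_gt0 a0 (ltr0Sn R 1)).
have cut n : exists E : {set {set G n}}, [/\ E \subset edges (G n),
    #|E| = Num.truncn (a * #|G n|%:R) &
    forall C : {set G n}, C \in components (delete_edges E) -> (#|C| <= K)%N].
  have [l [lin lcut]] :=
    greedy_decomposition (@adj_sym (G n)) (small n) [set: G n]%SET.
  set P := [set p | _ & _]%SET in lcut.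
  pose E0 : {set {set G n}} := [set [set p.1; p.2]%SET | p in P]%SET.
  have sE0 : E0 \subset edges (G n).
    apply/fintype.subsetP => _ /imsetP[p pP ->]; move: pP; rewrite inE.
    move=> /andP[/and3P[_ _ pa] _].
    by apply/imsetP; exists p; rewrite ?inE.
  have V0 : 0 <= a * #|G n|%:R by rewrite mulr_ge0 // ltW.
  have [|E [sE sEG cE]] := pad_edges (m := Num.truncn (a * #|G n|%:R)) sE0.
    apply/andP; split.
      rewrite truncn_ge_nat //; apply: le_trans (_ : #|P|%:R <= _).
        by rewrite ler_nat leq_imset_card.
      by move: lcut; rewrite -[_ *+ 2]mulr_natr mulfVK // finset.cardsT.
    (* A one-vertex graph has no edges, but there the target is 0 since [a < 1]. Otherwise twice the
       target is at most [#|G n|], hence at most twice the number of edges. *)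
    have tr := truncn_itv V0; have [cG|cG] := leqP #|G n| 1.
      rewrite (_ : Num.truncn _ = 0%N) //; apply/eqP; rewrite -leqn0 -ltnS.
      rewrite truncn_lt_nat //; apply: le_lt_trans (_ : a < _).
        by rewrite ler_piMr ?(ltW a0) // lern1.
      by rewrite (lt_le_trans _ a2) // ltr_pMr // ltr1n.
    rewrite -(leq_pmul2l (ltn0Sn 1)).
    apply: leq_trans (card_vertices_edges (conn n) cG).
    rewrite -(ler_nat R) natrM; case/andP: tr => tr _.
    apply: le_trans (ler_wpM2l _ tr) _ => //.
    by rewrite mulrA [2 * a]mulrC ler_piMl.
  exists E; split => // C; apply: (component_delete (l := l)).
  - move=> x y xy lxy; apply: (fintype.subsetP sE); apply/imsetP.
    by exists (x, y); rewrite ?inE /= /restr_rel ?finset.in_setT ?xy.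
  - by move=> x; case: (lin x (finset.in_setT x)).
  - by move=> x; case: (lin x (finset.in_setT x)).
pose E n := projT1 (cid (cut n)).
have EP n := projT2 (cid (cut n)); rewrite -/(E _) in EP.
(* The successor makes the bound positive, as hyperfiniteness demands. *)
exists K.+1, E; split => //.
- by move=> n; case: (EP n).
(* Rounding down changes the density by at most [1 / #|G n|], which is at most [r] once [#|G n|]
   exceeds the integer part of [r^-1]. *)
- exists a => //; apply/cvgrPdist_le => r r0.
  have /cvgnyPge/(_ (Num.truncn r^-1).+1) := Gy; apply: filterS => n nG.
  have [_ -> _] := EP n.
  have G0 : 0 < #|G n|%:R :> R by rewrite ltr0n; apply: leq_trans nG.
  have V0 : 0 <= a * #|G n|%:R by rewrite mulr_ge0 // ltW.
  have /andP[t1 t2] := truncn_itv V0.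
  rewrite ger0_norm ?subr_ge0 ?ler_pdivrMr // lerBlDr -lerBlDl ler_pdivlMr //.
  rewrite mulrBl lerBlDr (le_trans (ltW t2)) // -natr1 lerD2l.
  rewrite -ler_pdivrMl // mulr1.
  apply: le_trans (_ : (Num.truncn r^-1).+1%:R <= _).
    by have /andP[_ /ltW] := truncn_itv (ltW (etrans (invr_gt0 r) r0)).
  by rewrite ler_nat.
- by move=> n C; have [_ _ /(_ C)] := EP n => h /h /leqW.
Qed.
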